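(* Let $\alpha,\beta$ be complex numbers such that $\alpha+\beta$ and $\alpha\beta$ are integers, and let $f(x)$ be a normal divisibility polynomial. Then $A_n:=\dfrac{f(\alpha^n,\beta^n)}{f(\alpha,\beta)}$ is a linear divisibility sequence of integers, where $f(x,y):=y^{\deg(f)}f(x/y)$ denotes the homogenization of $f$.
   Context: A divisibility polynomial is a polynomial $f(x)$ with complex coefficients such that $f(x^m)\mid f(x^n)$ whenever $m\mid n$, for positive integers $m,n$. A polynomial is normal if it has leading coefficient $1$ and a non-zero constant term. The homogenization $f(x,y)=y^{\deg(f)}f(x/y)$ is a polynomial in two variables. A sequence of integers $a_n$ is a divisibility sequence if $a_m\mid a_n$ in $\mathbb{Z}$ whenever $m\mid n$, and a linear divisibility sequence if it moreover satisfies a linear recurrence $a_{n+k}=c_1a_{n+k-1}+\cdots+c_ka_n$ with constant coefficients $c_1,\dots,c_k$. *)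

(* Defs.v *)
From HB Require Import structures.
From mathcomp Require Import all_boot all_order all_algebra.
From mathcomp Require Import complex.
From mathcomp Require Import reals.

Set Implicit Arguments.
Unset Strict Implicit.
Unset Printing Implicit Defensive.

Import GRing.Theory.
Local Open Scope ring_scope.

Definition divisibility_poly (F : fieldType) (f : {poly F}) : Prop :=
  forall m n : nat, (0 < m)%N -> (0 < n)%N -> (m %| n)%N ->
    f \Po 'X^m %| f \Po 'X^n.

Definition normal_poly (F : fieldType) (f : {poly F}) : Prop :=
  f \is monic /\ f`_0 <> 0.

(* The value at (x, y) of the two-variable polynomial y ^ deg f * f (x / y),
   written monomial by monomial so that it is also correct at y = 0, where
   the total division x / y would not be; see homogenizationE. *)
Definition homogenization (F : fieldType) (f : {poly F}) (x y : F) : F :=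
  \sum_(i < size f) f`_i * x ^+ i * y ^+ ((size f).-1 - i).

Lemma homogenizationE (F : fieldType) (f : {poly F}) (x y : F) :
  y != 0 -> homogenization f x y = y ^+ (size f).-1 * f.[x / y].
Proof.
move=> y0; rewrite horner_coef mulr_sumr; apply: eq_bigr => i _.
have lei : (i <= (size f).-1)%N by rewrite -ltnS (ltn_predK (ltn_ord i)).
by rewrite expr_div_n expfB_cond ?(negPf y0) // mulrCA !mulrA mulrAC.
Qed.

Definition divisibility_sequence (a : nat -> int) : Prop :=
  forall m n : nat, (m %| n)%N -> (a m %| a n)%Z.

(* The coefficient usually written c_(i+1) is c i. *)
Definition linear_recurrence (a : nat -> int) : Prop :=
  exists (k : nat) (c : 'I_k -> int), forall n : nat,
    a (n + k)%N = \sum_(i < k) c i * a (n + k - i.+1)%N.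

Definition linear_divisibility_sequence (a : nat -> int) : Prop :=
  divisibility_sequence a /\ linear_recurrence a.

(* Main.v *)
Require Import Defs.
From HB Require Import structures.
From mathcomp Require Import all_boot all_order all_algebra.
From mathcomp Require Import cyclotomic.
From mathcomp Require Import complex.
From mathcomp Require Import reals.
From mathcomp Require Import ring zify.

Set Implicit Arguments.
Unset Strict Implicit.
Unset Printing Implicit Defensive.

Import GRing.Theory Num.Theory.
Local Open Scope ring_scope.

(** If [x] is a root of [f] of multiplicity [k], then [x ^+ n] is a root of
    multiplicity at least [k], since ['X^n] is unramified away from [0]. Hence
    the roots are roots of unity, primitive roots of the same order have the
    same multiplicity, and [f] is a product of cyclotomic polynomials: it is
    integral and, up to a constant, self-reciprocal. For [m %| n] the quotient
    of [f('X^n)] by [f('X^m)] is thus integral and palindromic, so that its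
    homogenization is symmetric and takes an integer value at [(alpha, beta)].
    The recurrence has characteristic polynomial
    [\prod_i ('X - alpha ^+ i * beta ^+ (deg f - i))], whose coefficients are
    symmetric in [alpha] and [beta]. *)

(** * Integers and integral polynomials inside a ring *)

Definition int_valued (R : pzRingType) (x : R) : Prop :=
  exists z : int, x = z%:~R.

Definition int_poly (R : nzRingType) (p : {poly R}) : Prop :=
  exists q : {poly int}, p = map_poly intr q.

Section IntValued.
Variable R : pzRingType.
Implicit Types x y : R.

Lemma int_valuedD x y : int_valued x -> int_valued y -> int_valued (x + y).
Proof. by move=> [a ->] [b ->]; exists (a + b); rewrite rmorphD. Qed.

Lemma int_valuedB x y : int_valued x -> int_valued y -> int_valued (x - y).
Proof. by move=> [a ->] [b ->]; exists (a - b); rewrite rmorphB. Qed.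

Lemma int_valuedM x y : int_valued x -> int_valued y -> int_valued (x * y).
Proof. by move=> [a ->] [b ->]; exists (a * b); rewrite rmorphM. Qed.

Lemma int_valuedX x n : int_valued x -> int_valued (x ^+ n).
Proof. by move=> [a ->]; exists (a ^+ n); rewrite rmorphXn. Qed.

End IntValued.

Section IntPoly.
Variable R : comNzRingType.
Implicit Types p q : {poly R}.

Lemma int_poly1 : int_poly (1 : {poly R}).
Proof. by exists 1; rewrite rmorph1. Qed.

Lemma int_polyX : int_poly ('X : {poly R}).
Proof. by exists 'X; rewrite map_polyX. Qed.

Lemma int_polyC (x : R) : int_valued x -> int_poly x%:P.
Proof. by case=> z ->; exists z%:P; rewrite map_polyC. Qed.

Lemma int_polyD p q : int_poly p -> int_poly q -> int_poly (p + q).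
Proof. by move=> [a ->] [b ->]; exists (a + b); rewrite rmorphD. Qed.

Lemma int_polyB p q : int_poly p -> int_poly q -> int_poly (p - q).
Proof. by move=> [a ->] [b ->]; exists (a - b); rewrite rmorphB. Qed.

Lemma int_polyM p q : int_poly p -> int_poly q -> int_poly (p * q).
Proof. by move=> [a ->] [b ->]; exists (a * b); rewrite rmorphM. Qed.

Lemma int_poly_comp_Xn p n : int_poly p -> int_poly (p \Po 'X^n).
Proof. by move=> [a ->]; exists (a \Po 'X^n); rewrite map_comp_poly map_polyXn. Qed.

Lemma int_valued_coef p i : int_poly p -> int_valued p`_i.
Proof. by case=> a ->; exists a`_i; rewrite coef_map. Qed.

End IntPoly.

(** * Integral quotients and cyclotomic polynomials *)

Section NumField.
Variable F : numFieldType.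
Implicit Types (p q : {poly F}) (x y z : F).

(** Divide over the integers by the monic [b]. The difference of [p] and the integral quotient,
    times [q], is the remainder, whose degree is below that of [q]; so the difference is 0. *)
Lemma int_poly_quotient p q :
  q \is monic -> int_poly q -> int_poly (p * q) -> int_poly p.
Proof.
move=> qm [b qE] [a pqE].
have mapsz (c : {poly int}) : size (map_poly intr c : {poly F}) = size c.
  by apply: size_map_inj_poly; [exact: intr_inj | exact: rmorph0].
have bm : b \is monic.
  move: qm; rewrite qE !monicE lead_coef_map_inj; [|exact: intr_inj|exact: rmorph0].
  by rewrite -[1]/(1%:~R) eqr_int.
exists (Pdiv.Ring.rdivp a b); apply/eqP; rewrite -subr_eq0.
have [_ | nz] := eqVneq (p - map_poly intr (Pdiv.Ring.rdivp a b)) 0; first by [].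
have q0 : q != 0 by exact: monic_neq0.
have E : (p - map_poly intr (Pdiv.Ring.rdivp a b)) * q = map_poly intr (Pdiv.Ring.rmodp a b).
  rewrite mulrBl pqE {1}(Pdiv.RingMonic.rdivp_eq bm a) rmorphD rmorphM /= -qE.
  by rewrite addrC addKr.
have := Pdiv.Ring.ltn_rmodpN0 a (monic_neq0 bm); rewrite -mapsz -E -(mapsz b) -qE size_mul //.
have := nz; rewrite -size_poly_gt0.
by move: (size _) (size _) => k l; lia.
Qed.

(** Strong induction on [n]: in ['X^n - 1], the product of the factors for proper divisors is monic
    and integral, hence so is the cofactor. *)
Lemma int_poly_cyclotomic z n :
  n.-primitive_root z -> int_poly (cyclotomic z n).
Proof.
elim/ltn_ind: n z => n IH z pz.
have n0 := prim_order_gt0 pz.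
have := prod_cyclotomic pz.
rewrite (bigD1_seq n) ?divisors_uniq ?divisors_id //= divnn n0 expr1 => E.
apply: (@int_poly_quotient _
  (\prod_(d <- divisors n | d != n) cyclotomic (z ^+ (n %/ d)) d)).
- by apply: monic_prod => d _; exact: cyclotomic_monic.
- rewrite big_seq_cond; apply: (big_ind (@int_poly F)).
  + exact: int_poly1.
  + by move=> ? ?; exact: int_polyM.
  + move=> d /andP[]; rewrite -dvdn_divisors // => dn nd; apply: IH.
      by rewrite ltn_neqAle nd dvdn_leq.
    exact: dvdn_prim_root.
- by rewrite -E; exists ('X^n - 1); rewrite rmorphB rmorph1 /= map_polyXn.
Qed.

Lemma prim_order_uniq x d e :
  d.-primitive_root x -> e.-primitive_root x -> d = e.
Proof.
move=> pd pe; apply/eqP; rewrite eqn_dvd (prim_order_dvd pd) (prim_expr_order pe).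
by rewrite (prim_order_dvd pe) (prim_expr_order pd) !eqxx.
Qed.

Lemma uniq_cyclotomic_roots z n : n.-primitive_root z ->
  uniq [seq z ^+ i | i : 'I_n in [pred i : 'I_n | coprime i n]].
Proof.
move=> pz; rewrite map_inj_in_uniq ?enum_uniq // => i j _ _ /eqP.
rewrite (eq_prim_root_expr pz) => /eqP.
by rewrite !modn_small ?ltn_ord // => /val_inj.
Qed.

Lemma mup_cyclotomic z n x : n.-primitive_root z ->
  mup x (cyclotomic z n) = n.-primitive_root x :> nat.
Proof.
move=> pz; rewrite -(root_cyclotomic pz).
have -> : cyclotomic z n =
    \prod_(y <- [seq z ^+ i | i : 'I_n in [pred i : 'I_n | coprime i n]])
      ('X - y%:P) by rewrite big_image.
by rewrite mu_prod_XsubC root_prod_XsubC count_uniq_mem ?uniq_cyclotomic_roots.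
Qed.

Lemma mup_gt0 p x : p != 0 -> (0 < mup x p)%N = root p x.
Proof. by move=> p0; rewrite -XsubC_dvd // dvdp_XsubCl. Qed.

End NumField.

(** * Root multiplicities over an algebraically closed field *)

Section ClosedField.
Variable F : numClosedFieldType.
Implicit Types (p q f g : {poly F}) (x y z : F).

(* A monic polynomial whose roots are roots of unity and whose multiplicities
   depend only on the order of the root is a product of cyclotomic polynomials,
   split off here one at a time. *)
Lemma int_poly_mup_prim p : p \is monic ->
  (forall x, root p x -> exists2 d, d.-primitive_root x &
     forall y, d.-primitive_root y -> mup y p = mup x p) ->
  int_poly p.
Proof.
have [n] := ubnP (size p); elim: n p => // n IH p ltn pm H.
have p0 := monic_neq0 pm.
have [/size_poly1P[c c0 pE]|] := boolP (size p == 1%N).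
  move: pm; rewrite pE monicE lead_coefC => /eqP ->; exact: int_poly1.
move=> /closed_rootP[z rz].
have [d pz Hz] := H z rz.
have cm := cyclotomic_monic z d.
have c0 := monic_neq0 cm.
have /dvdpP[q pE] : cyclotomic z d %| p.
  have -> : cyclotomic z d =
    \prod_(y <- [seq z ^+ i | i : 'I_d in [pred i : 'I_d | coprime i d]])
      ('X - y%:P) by rewrite big_image.
  apply: uniq_roots_dvdp; last by rewrite uniq_rootsE uniq_cyclotomic_roots.
  apply/allP => y /imageP[k ck ->]; rewrite -mup_gt0 // Hz ?mup_gt0 //.
  by rewrite prim_root_exp_coprime.
have q0 : q != 0 by apply: contraNneq p0 => q0; rewrite pE q0 mul0r.
rewrite pE; apply: int_polyM; last exact: int_poly_cyclotomic.
apply: IH.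
- move: ltn; rewrite pE size_Mmonic // size_cyclotomic addnS /= ltnS.
  apply: leq_trans; rewrite -addn1 leq_add2l totient_gt0; exact: prim_order_gt0 pz.
- by rewrite -(monicMr _ cm) -pE.
move=> x rx.
have [|e px Hx] := H x; first by rewrite pE rootM rx.
exists e => // y py.
have := Hx y py; rewrite pE !mupM // !mup_cyclotomic //.
(* The cyclotomic factor contributes 1 exactly at points of order [d], so it lowers both
   multiplicities equally, [x] and [y] having the same order [e]. *)
suff -> : d.-primitive_root y = d.-primitive_root x by move/addIn.
apply/idP/idP => [dy|dx].
  by rewrite (prim_order_uniq dy py).
by rewrite (prim_order_uniq dx px).
Qed.

(** Split off the full power of ['X - x ^+ n] from [p]. After substitution, ['X^n - x ^+ n] is
    ['X - x] times a sum worth [n * x ^+ n.-1] at [x], nonzero in characteristic 0. *)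
Lemma mup_comp_Xn p x n : p != 0 -> x != 0 -> (0 < n)%N ->
  mup x (p \Po 'X^n) = mup (x ^+ n) p.
Proof.
move=> p0 x0 n0.
have /(_ _ (leqnn _)) : forall k, (k <= mup (x ^+ n) p)%N ->
    ('X - (x ^+ n)%:P) ^+ k %| p by move=> k; rewrite mup_geq.
set k := mup _ p => /dvdpP[q pE].
have q0 : q != 0 by apply: contraNneq p0 => q0; rewrite pE q0 mul0r.
have Nq : ~~ root q (x ^+ n).
  rewrite -mup_gt0 // -leqNgt -(leq_add2r k) add0n.
  by rewrite {2}/k pE mupM ?expf_neq0 ?polyXsubC_eq0 // mup_XsubCX eqxx.
rewrite pE rmorphM rmorphXn rmorphB /= comp_polyX comp_polyC.
rewrite mupMr; last by rewrite root_comp hornerXn.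
rewrite polyC_exp subrXX exprMn mupMl ?mup_XsubCX ?eqxx //.
rewrite rootE horner_exp expf_eq0 negb_and; apply/orP; right.
rewrite horner_sum (eq_bigr (fun=> x ^+ n.-1)) => [|i _].
  rewrite sumr_const card_ord -mulr_natr mulf_neq0 ?expf_neq0 //.
  by rewrite pnatr_eq0 -lt0n.
have lti := ltn_ord i.
rewrite -polyC_exp hornerM hornerXn hornerC -exprD; congr (_ ^+ _).
by rewrite subnK // -ltnS prednK.
Qed.


Lemma root_coef0_neq0 f x : f`_0 <> 0 -> root f x -> x != 0.
Proof.
by move=> f0; apply: contraTneq => ->; rewrite rootE horner_coef0; apply/eqP.
Qed.

(** * Normal divisibility polynomials: roots, integrality, reciprocity, quotients *)

Section DivisibilityPoly.
Variable f : {poly F}.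
Hypothesis normal_f : normal_poly f.
Hypothesis div_f : divisibility_poly f.

Let f_monic : f \is monic. Proof. by case: normal_f. Qed.
Let f_neq0 : f != 0. Proof. exact: monic_neq0. Qed.

(** The hypothesis for [1 %| n] says that [f] divides [f \Po 'X^n]. *)
Lemma divisibility_poly_mup x n : x != 0 -> (0 < n)%N ->
  (mup x f <= mup (x ^+ n) f)%N.
Proof.
move=> x0 n0; rewrite -mup_comp_Xn // mup_geq.
  have := div_f (isT : 0 < 1)%N n0 (dvd1n _); rewrite expr1 comp_polyXr.
  by apply: dvdp_trans; rewrite -mup_geq.
by rewrite comp_poly_eq0 // size_polyXn ltnS.
Qed.

Lemma divisibility_poly_root_prim x : root f x -> exists d, d.-primitive_root x.
Proof.
move=> rx; have x0 := root_coef0_neq0 normal_f.2 rx.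
have rX n : root f (x ^+ n.+1).
  rewrite -mup_gt0 //; apply: leq_trans (divisibility_poly_mup x0 (ltn0Sn n)).
  by rewrite mup_gt0.
(* Pigeonhole: these are [size f] roots, one more than the degree, so two powers of [x] coincide. *)
have /uniqPn-/(_ 0) : ~~ uniq [seq x ^+ i.+1 | i <- iota 0 (size f)].
  apply: contraTN isT => un; have := max_poly_roots f_neq0 _ un.
  rewrite size_map size_iota ltnn; apply.
  by apply/allP => _ /mapP[i _ ->]; exact: rX.
case=> i [j []]; rewrite size_map size_iota => ij jf.
rewrite !(nth_map 0%N) ?size_iota ?(ltn_trans ij) // !nth_iota ?(ltn_trans ij) //.
rewrite !add0n => /eqP E.
have ji0 : (0 < j - i)%N by rewrite subn_gt0.
suff xji : x ^+ (j - i) = 1 by have [d pd _] := prim_order_exists ji0 xji; exists d.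
apply: (mulfI (expf_neq0 i.+1 x0)); rewrite mulr1 -exprD (eqP E); congr (_ ^+ _).
by rewrite addSn subnKC // ltnW.
Qed.

Lemma divisibility_poly_mup_prim x y d :
  d.-primitive_root x -> d.-primitive_root y -> mup x f = mup y f.
Proof.
have le u v : d.-primitive_root u -> d.-primitive_root v -> (mup u f <= mup v f)%N.
  move=> pu pv; have [k ->] := prim_rootP pu (prim_expr_order pv).
  have d0 := prim_order_gt0 pu.
  (* The exponent [k] may be 0; adding the order makes it positive. *)
  have -> : u ^+ k = u ^+ (k + d) by rewrite exprD (prim_expr_order pu) mulr1.
  apply: divisibility_poly_mup; last by rewrite addn_gt0 d0 orbT.
  by rewrite (prim_root_eq0 pu) -lt0n.
by move=> px py; apply/eqP; rewrite eqn_leq !le.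
Qed.

Lemma divisibility_poly_int : int_poly f.
Proof.
apply: int_poly_mup_prim => // x rx.
have [d pd] := divisibility_poly_root_prim rx.
by exists d => // y py; exact: divisibility_poly_mup_prim py pd.
Qed.

(** The inverse of a root of unity is again primitive of the same order. *)
Lemma divisibility_poly_mupV x : mup x^-1 f = mup x f.
Proof.
have le y : root f y -> (mup y f <= mup y^-1 f)%N.
  move=> ry; have [d pd] := divisibility_poly_root_prim ry.
  have d0 := prim_order_gt0 pd.
  rewrite (divisibility_poly_mup_prim pd (y := y^-1)) //.
  have y0 := root_coef0_neq0 normal_f.2 ry.
  have -> : y^-1 = y ^+ d.-1.
    apply: (mulfI y0); rewrite divff // -exprS prednK //.
    by rewrite (prim_expr_order pd).
  rewrite prim_root_exp_coprime //; exact: coprimePn.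
have le' y : (mup y f <= mup y^-1 f)%N.
  by have [/le //|/mupNroot ->] := boolP (root f y).
by apply/eqP; rewrite eqn_leq le' -{2}(invrK x) le'.
Qed.

(** Inversion permutes the roots with multiplicity, and [(y^-1 - x) * y = - x * (y - x^-1)]; hence
    [c] is the product of the [- x]. *)
Lemma divisibility_poly_reciprocal : exists2 c, c != 0 &
  forall y, y != 0 -> f.[y^-1] * y ^+ (size f).-1 = c * f.[y].
Proof.
have [s fE] := closed_field_poly_normal f.
move: fE; rewrite (monicP f_monic) scale1r => fE.
have sV : perm_eq s (map GRing.inv s).
  apply/allP => x _ /=; rewrite count_map -mu_prod_XsubC -fE.
  rewrite -divisibility_poly_mupV fE mu_prod_XsubC; apply/eqP/eq_count => y /=.
  by rewrite -(inj_eq invr_inj) invrK.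
have s0 x : x \in s -> x != 0.
  move=> xs; apply: root_coef0_neq0 normal_f.2 _.
  by rewrite fE root_prod_XsubC.
exists (\prod_(x <- s) - x).
  rewrite prodf_seq_neq0; apply/allP => x /s0; by rewrite oppr_eq0.
move=> y y0.
have -> : (size f).-1 = size s by rewrite fE size_prod_XsubC.
have <- : \prod_(x <- s) y = y ^+ size s.
  by rewrite big_const_seq count_predT iter_mulr_1.
have fV : f.[y] = \prod_(x <- s) (y - x^-1).
  rewrite fE horner_prod (perm_big _ sV) big_map.
  by apply: eq_bigr => x _; rewrite hornerXsubC.
rewrite fV fE horner_prod -!big_split /=.
apply: eq_big_seq => x /s0 x0; rewrite !hornerXsubC mulrBl mulVf //.
by rewrite mulrBr !mulNr mulfV // opprK addrC.
Qed.

(** The reciprocity constant [c] is the same for [f \Po 'X^n] and [f \Po 'X^m], so it cancels in the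
    quotient. *)
Lemma divisibility_poly_quotient_palindrome g m n : (0 < m)%N -> (0 < n)%N ->
  f \Po 'X^n = g * (f \Po 'X^m) ->
  forall i, (i < size g)%N -> g`_i = g`_((size g).-1 - i).
Proof.
move=> m0 n0 gE; have [c c0 Hc] := divisibility_poly_reciprocal.
have fX0 k : (0 < k)%N -> f \Po 'X^k != 0.
  by move=> k0; rewrite comp_poly_eq0 // size_polyXn ltnS.
have g0 : g != 0 by apply: contraNneq (fX0 _ n0) => g0; rewrite gE g0 mul0r.
pose d := (size f).-1.
have szE : (d * n = (size g).-1 + d * m)%N.
  have szX k : (size (f \Po 'X^k)).-1 = (d * k)%N by rewrite size_comp_poly size_polyXn.
  rewrite -!szX gE size_mul ?fX0 //.
  have := fX0 _ m0; have := g0; rewrite -!size_poly_gt0.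
  by move: (size _) (size _) => k l; lia.
have HcX k y : y != 0 -> f.[(y ^+ k)^-1] * y ^+ (d * k) = c * f.[y ^+ k].
  by move=> y0; rewrite mulnC exprM Hc // expf_neq0.
have gV y : y != 0 -> f.[y ^+ m] != 0 -> g.[y^-1] * y ^+ (size g).-1 = g.[y].
  move=> y0 fy0; apply: (mulIf (mulf_neq0 c0 fy0)).
  have gy z : g.[z] * f.[z ^+ m] = f.[z ^+ n].
    by have := congr1 (horner^~ z) gE; rewrite hornerM !horner_comp !hornerXn.
  rewrite [RHS]mulrCA gy -HcX // -HcX // szE exprD -!exprVn -gy; ring.
(* The reversal of [g], to be identified with [g] by values. *)
pose r := \poly_(i < size g) g`_((size g).-1 - i).
have rE y : y != 0 -> r.[y] = g.[y^-1] * y ^+ (size g).-1.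
  move=> y0; rewrite horner_poly horner_coef mulr_suml (reindex_inj rev_ord_inj) /=.
  apply: eq_bigr => i _.
  have -> : ((size g).-1 - (size g - i.+1) = i)%N.
    by case: i => i /=; move: (size g) => N; lia.
  rewrite -mulrA; congr (_ * _).
  have -> : ((size g).-1 = i + (size g - i.+1))%N.
    by case: i => i /=; move: (size g) => N; lia.
  by rewrite exprD mulrA -exprMn mulVf // expr1n mul1r.
suff rg : r = g by move=> i ig; rewrite -{1}rg coef_poly ig.
apply/eqP; rewrite -subr_eq0.
(* The extra factor vanishes at the points that [gV] excludes. Were the product nonzero, it would
   have a non-root, where [r] and [g] nevertheless agree. *)
suff : (r - g) * ('X * (f \Po 'X^m)) == 0.
  by rewrite !mulf_eq0 polyX_eq0 (negPf (fX0 _ m0)) !orbF.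
apply/negPn/negP => /closed_nonrootP[y].
rewrite rootE !hornerM hornerX horner_comp hornerXn !mulf_eq0 !negb_or.
by case/and3P => /[swap] y0 /[swap] fy0; rewrite hornerD hornerN rE // gV // subrr eqxx.
Qed.

Lemma divisibility_poly_quotient_int g m n : (0 < m)%N ->
  f \Po 'X^n = g * (f \Po 'X^m) -> int_poly g.
Proof.
move=> m0 gE; apply: (@int_poly_quotient _ _ (f \Po 'X^m)).
- rewrite monicE lead_coef_comp ?size_polyXn ?ltnS //.
  by rewrite lead_coefXn expr1n mulr1 -monicE.
- exact/int_poly_comp_Xn/divisibility_poly_int.
- by rewrite -gE; exact/int_poly_comp_Xn/divisibility_poly_int.
Qed.

(** A root [x] of order [d] makes [x ^+ d = 1] a root. This serves index 0, about which
    [divisibility_poly] says nothing. *)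
Lemma divisibility_poly_root1 : f = 1 \/ root f 1.
Proof.
have [/size_poly1P[c c0 fE]|/closed_rootP[x rx]] := boolP (size f == 1%N).
  by left; move: f_monic; rewrite fE monicE lead_coefC => /eqP ->.
right; have [d pd] := divisibility_poly_root_prim rx.
have x0 := root_coef0_neq0 normal_f.2 rx.
rewrite -mup_gt0 // -(prim_expr_order pd).
apply: leq_trans (divisibility_poly_mup x0 (prim_order_gt0 pd)).
by rewrite mup_gt0.
Qed.

End DivisibilityPoly.
End ClosedField.

(** * Homogenization under products and substitution of powers *)

Section Homogenization.
Variable F : fieldType.
Implicit Types (p q : {poly F}) (x y : F).

(** Only the leading monomial survives at [y = 0], the case that [homogenizationE] leaves out. *)
Lemma homogenization_y0 p x :
  homogenization p x 0 = lead_coef p * x ^+ (size p).-1.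
Proof.
rewrite /homogenization; have [->|p0] := eqVneq p 0.
  by rewrite size_poly0 big_ord0 lead_coef0 mul0r.
rewrite lead_coefE; move: p0; rewrite -size_poly_gt0; case: (size p) => // n _.
rewrite big_ord_recr /= subnn mulr1 big1 ?add0r // => i _.
by rewrite expr0n subn_eq0 leqNgt ltn_ord mulr0.
Qed.

Lemma homogenizationM p q x y :
  homogenization (p * q) x y = homogenization p x y * homogenization q x y.
Proof.
have h0 : homogenization (0 : {poly F}) x y = 0.
  by rewrite /homogenization size_poly0 big_ord0.
have [->|p0] := eqVneq p 0; first by rewrite mul0r h0 mul0r.
have [->|q0] := eqVneq q 0; first by rewrite mulr0 h0 mulr0.
have sz : (size (p * q)).-1 = ((size p).-1 + (size q).-1)%N.
  rewrite size_mul //; move: p0 q0; rewrite -!size_poly_gt0.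
  by move: (size _) (size _) => k l; lia.
have [->|y0] := eqVneq y 0.
  by rewrite !homogenization_y0 lead_coefM sz exprD mulrACA.
by rewrite !homogenizationE // sz hornerM exprD mulrACA.
Qed.

Lemma homogenization_comp_Xn p n x y : (0 < n)%N ->
  homogenization (p \Po 'X^n) x y = homogenization p (x ^+ n) (y ^+ n).
Proof.
move=> n0.
have sz : (size (p \Po 'X^n)).-1 = ((size p).-1 * n)%N.
  by rewrite size_comp_poly size_polyXn.
have [->|y0] := eqVneq y 0.
  rewrite expr0n gtn_eqF // !homogenization_y0 sz lead_coef_comp.
    by rewrite lead_coefXn expr1n mulr1 mulnC exprM.
  by rewrite size_polyXn ltnS.
rewrite !homogenizationE ?expf_neq0 // sz horner_comp hornerXn.
by rewrite mulnC exprM expr_div_n.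
Qed.

Lemma homogenization1 x y : homogenization (1 : {poly F}) x y = 1.
Proof. by rewrite /homogenization size_poly1 big_ord1 coef1 !mulr1. Qed.

End Homogenization.

(** * Integrality of symmetric expressions in [a] and [b] *)

Section SymmetricValues.
Variables (R : comNzRingType) (a b : R).
Hypothesis sum_int : int_valued (a + b).
Hypothesis prod_int : int_valued (a * b).

Lemma int_valued_power_sum n : int_valued (a ^+ n + b ^+ n).
Proof.
elim/ltn_ind: n => -[|[|n]] IH; first by exists 2.
  by rewrite !expr1.
have -> : a ^+ n.+2 + b ^+ n.+2 =
  (a + b) * (a ^+ n.+1 + b ^+ n.+1) - a * b * (a ^+ n + b ^+ n).
  rewrite !exprS; ring.
by apply: int_valuedB; apply: int_valuedM => //; apply: IH.
Qed.

(** The two outer terms combine to [c n * (a ^+ n + b ^+ n)]; the inner ones are [a * b] times a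
    palindromic sum of degree [n - 2]. *)
Lemma int_valued_palindrome (c : nat -> R) n :
  (forall i, int_valued (c i)) -> (forall i, (i <= n)%N -> c i = c (n - i)%N) ->
  int_valued (\sum_(i < n.+1) c i * a ^+ i * b ^+ (n - i)).
Proof.
elim/ltn_ind: n c => -[|[|n]] IH c c_int c_pal.
- by rewrite big_ord1 !mulr1.
- rewrite big_ord_recl big_ord1 /= (c_pal 0%N) // !expr1 !expr0 !mulr1 -mulrDr.
  by apply: int_valuedM; rewrite // addrC.
rewrite big_ord_recl big_ord_recr /= subn0 subnn expr0 !mulr1.
rewrite (c_pal 0%N) // subn0 /bump /=.
rewrite (eq_bigr (fun i : 'I_n.+1 =>
    a * b * (c i.+1 * a ^+ i * b ^+ (n - i)))) => [|i _]; last first.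
  rewrite add1n -[in LHS](prednK (n := n.+2 - i.+1)); last by have := ltn_ord i; lia.
  have -> : (n.+2 - i.+1).-1 = (n - i)%N by have := ltn_ord i; lia.
  by rewrite !exprS; ring.
rewrite -mulr_sumr addrCA -mulrDr; apply: int_valuedD.
  apply: int_valuedM => //; apply: (IH n _ (fun i => c i.+1)) => // i lin.
  rewrite c_pal; last by lia.
  by congr c; lia.
by rewrite addrC; apply: int_valuedM => //; exact: int_valued_power_sum.
Qed.

(** The power [j] is there for the induction: once the factors for [i = 0] and [i = n] are paired
    off, each remaining root contains a further [a * b], and [j] becomes [j.+1]. *)
Lemma int_poly_prod_symmetric n j : int_poly
  (\prod_(i < n.+1) ('X - ((a * b) ^+ j * (a ^+ i * b ^+ (n - i)))%:P)).
Proof.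
have pair k m : int_poly (('X - ((a * b) ^+ m * b ^+ k)%:P)
                          * ('X - ((a * b) ^+ m * a ^+ k)%:P)).
  have -> : ('X - ((a * b) ^+ m * b ^+ k)%:P) * ('X - ((a * b) ^+ m * a ^+ k)%:P)
    = ('X - ((a * b) ^+ m * (a ^+ k + b ^+ k))%:P) * 'X
      + ((a * b) ^+ m * (a * b) ^+ m * (a * b) ^+ k)%:P.
    by rewrite !exprMn !(rmorphD, rmorphM) /=; ring.
  apply: int_polyD; last by apply: int_polyC; do 2?apply: int_valuedM; exact: int_valuedX.
  apply: int_polyM; last exact: int_polyX.
  apply: int_polyB; first exact: int_polyX.
  apply: int_polyC; apply: int_valuedM; first exact: int_valuedX.
  exact: int_valued_power_sum.
elim/ltn_ind: n j => -[|[|n]] IH j.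
- rewrite big_ord1 !mulr1; apply: int_polyB; first exact: int_polyX.
  by apply: int_polyC; exact: int_valuedX.
- by rewrite big_ord_recl big_ord1 /= !expr0 mulr1 mul1r; exact: (pair 1%N).
rewrite big_ord_recl big_ord_recr /= subn0 subnn expr0 mulr1 mul1r /bump /=.
rewrite mulrCA; apply: int_polyM; last exact: pair.
rewrite (eq_bigr (fun i : 'I_n.+1 =>
  'X - ((a * b) ^+ j.+1 * (a ^+ i * b ^+ (n - i)))%:P)) => [|i _]; first exact: IH.
rewrite add1n -[in LHS](prednK (n := n.+2 - i.+1)); last by have := ltn_ord i; lia.
have -> : (n.+2 - i.+1).-1 = (n - i)%N by have := ltn_ord i; lia.
by congr ('X - _%:P); rewrite !exprS; ring.
Qed.

End SymmetricValues.

(** * Linear recurrences from exponential sums *)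

Lemma linear_recurrence_exp_sum (F : numDomainType) (k : nat) (u w : 'I_k -> F)
    (A : nat -> int) :
  int_poly (\prod_(i < k) ('X - (w i)%:P)) ->
  (forall n, (A n)%:~R = \sum_(i < k) u i * w i ^+ n) ->
  linear_recurrence A.
Proof.
move=> [P PE] AE.
have szP : size P = k.+1.
  rewrite -(size_map_inj_poly (f := intr : int -> F)) ?mulr0z //; last exact: intr_inj.
  by rewrite -PE size_prod_XsubC /index_enum -enumT size_enum_ord.
have lcP : P`_k = 1.
  apply: (@intr_inj F); rewrite -coef_map /= -PE.
  have := monic_prod_XsubC (index_enum 'I_k) xpredT w.
  rewrite monicE lead_coefE size_prod_XsubC /index_enum -enumT size_enum_ord /=.
  by move=> /eqP ->.
(* The monic characteristic polynomial [P] read from the top: the coefficient of degree [k - i.+1]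
   goes with the term of index [n + k - i.+1]. *)
exists k, (fun i => - P`_(k - i.+1)) => n.
have root_rec : \sum_(j < k.+1) P`_j * A (n + j)%N = 0.
  apply: (@intr_inj F); rewrite rmorph_sum /=.
  transitivity (\sum_(i < k) u i * w i ^+ n * (map_poly intr P).[w i]).
    under eq_bigr => j _ do rewrite rmorphM /= AE mulr_sumr.
    rewrite exchange_big /=; apply: eq_bigr => i _.
    rewrite horner_coef size_map_inj_poly ?mulr0z //; last exact: intr_inj.
    rewrite szP mulr_sumr; apply: eq_bigr => j _.
    by rewrite coef_map exprD /=; ring.
  apply: big1 => i _; rewrite -PE horner_prod (bigD1 i) //= hornerXsubC subrr.
  by rewrite mul0r mulr0.
move: root_rec; rewrite big_ord_recr /= lcP mul1r => /eqP.
rewrite addrC addr_eq0 => /eqP ->; rewrite -sumrN (reindex_inj rev_ord_inj) /=.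
apply: eq_bigr => i _; rewrite mulNr; congr (- (_ * A _)).
by have := ltn_ord i; lia.
Qed.

(** * Integrality, divisibility and recurrence of the quotient sequence *)

Theorem theorem5 (R : realType) (alpha beta : R[i]) (f : {poly R[i]})
    (sum_int : exists s : int, alpha + beta = s%:~R)
    (prod_int : exists p : int, alpha * beta = p%:~R)
    (normal_f : normal_poly f)
    (div_f : divisibility_poly f)
    (f_neq0 : homogenization f alpha beta <> 0) :
  exists A : nat -> int,
    (forall n : nat,
       homogenization f (alpha ^+ n) (beta ^+ n) / homogenization f alpha beta
       = (A n)%:~R) /\
    linear_divisibility_sequence A.
Proof.
have hf0 : homogenization f alpha beta != 0 by apply/eqP.
(* Stated for numerators, this gives integrality of the terms at [m = 1] and divisibility in
   general. *)
have quot m n : (m %| n)%N -> exists G : int,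
    homogenization f (alpha ^+ n) (beta ^+ n)
    = G%:~R * homogenization f (alpha ^+ m) (beta ^+ m).
  case: m => [|m]; first by rewrite dvd0n => /eqP ->; exists 1; rewrite mul1r.
  have [-> | r1] := divisibility_poly_root1 normal_f div_f.
    by exists 1; rewrite !homogenization1 mulr1.
  (* At [n = 0] the numerator is [f.[1] = 0], so [G = 0] works for every [m]. *)
  case: n => [_|n mn].
    exists 0; rewrite mul0r !expr0 homogenizationE ?oner_eq0 // divr1.
    by rewrite (rootP r1) mulr0.
  have /dvdpP[g gE] := div_f _ _ (ltn0Sn m) (ltn0Sn n) mn.
  have g_int := divisibility_poly_quotient_int normal_f div_f (ltn0Sn m) gE.
  have g_pal :=
    divisibility_poly_quotient_palindrome normal_f div_f (ltn0Sn m) (ltn0Sn n) gE.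
  have [G GE] : int_valued (homogenization g alpha beta).
    rewrite /homogenization; case: (size g) g_pal => [|k] g_pal.
      by rewrite big_ord0; exists 0.
    apply: (int_valued_palindrome sum_int prod_int (c := fun i => g`_i)) => // i.
    exact: int_valued_coef.
  exists G; rewrite -GE -!homogenization_comp_Xn // gE; exact: homogenizationM.
have A_ex n : exists z : int,
    homogenization f (alpha ^+ n) (beta ^+ n) / homogenization f alpha beta == z%:~R.
  have [G] := quot 1%N n (dvd1n n); rewrite !expr1 => ->.
  by exists G; rewrite mulfK.
pose A n := xchoose (A_ex n).
have AE n : homogenization f (alpha ^+ n) (beta ^+ n) / homogenization f alpha beta
    = (A n)%:~R by apply/eqP; exact: (xchooseP (A_ex n)).
exists A; split=> //; split=> [m n mn|].
  have [G GE] := quot m n mn; apply/dvdzP; exists G.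
  by apply: (@intr_inj R[i]); rewrite rmorphM /= -!AE GE mulrA.
have szf : size f = (size f).-1.+1.
  by rewrite prednK // size_poly_gt0 monic_neq0 //; case: normal_f.
(* Each monomial of the homogenization at the [n]-th powers is a coefficient of [f] times an [n]-th
   power, so every term is an exponential sum. *)
apply: (@linear_recurrence_exp_sum _ (size f)
  (fun i => f`_i / homogenization f alpha beta)
  (fun i => alpha ^+ i * beta ^+ ((size f).-1 - i))).
  have := int_poly_prod_symmetric sum_int prod_int (size f).-1 0.
  rewrite -szf; congr int_poly; apply: eq_bigr => i _.
  by rewrite expr0 mul1r.
move=> n; rewrite -AE /homogenization mulr_suml; apply: eq_bigr => i _.
by rewrite exprMn -!exprM ![(n * _)%N]mulnC; ring.
Qed.
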